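(* Let $b\ge 2$ be an integer and let $X$ be any positive continuous random variable. For $j\ge 1$ let $A_{[j]}$ be the $j$-th most significant $b$-ary digit of $X$. Then for every $a\in\{0,1,\ldots,b-1\}$, $$\lim_{j\to\infty}\Pr(A_{[j]}=a)=b^{-1}.$$
   Context: A continuous random variable is one that has a probability density function. $\{z\}=z-\lfloor z\rfloor$ is the fractional part. The $j$-th integer significand of $X$ is $A_{(j)}=\lfloor b^{\{\log_b X\}+j-1}\rfloor\in\{b^{j-1},\ldots,b^j-1\}$, and the $j$-th most significant $b$-ary digit is $A_{[j]}=A_{(j)}\bmod b\in\{0,1,\ldots,b-1\}$. *)

(* Defs.v *)
From HB Require Import structures.
From mathcomp Require Import all_boot all_order all_algebra.
From mathcomp Require Import all_classical all_reals all_analysis.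
Set Implicit Arguments.
Unset Strict Implicit.
Unset Printing Implicit Defensive.
Import Order.TTheory GRing.Theory Num.Theory.
Import numFieldNormedType.Exports.
Local Open Scope classical_set_scope.
Local Open Scope ring_scope.

Definition continuous_RV d (T : measurableType d) (R : realType)
    (P : probability T R) (X : {RV P >-> R}) : Prop :=
  exists f : R -> R,
    [/\ measurable_fun [set: R] f,
        forall x, 0 <= f x &
        forall A : set R, measurable A ->
          distribution P X A = (\int[lebesgue_measure]_(x in A) (f x)%:E)%E].

Definition fracpart (R : realType) (z : R) : R := z - (Num.floor z)%:~R.

Definition logb (R : realType) (b : nat) (x : R) : R := ln x / ln b%:R.

(* [j - 1] is a real subtraction; indices start at [j = 1], and the value at
   [j = 0] carries no meaning. *)
Definition int_significand (R : realType) (b j : nat) (x : R) : int :=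
  Num.floor (b%:R `^ (fracpart (logb b x) + j%:R - 1)).

Definition digit (R : realType) (b j : nat) (x : R) : int :=
  (int_significand b j x %% b)%Z.

(* Main.v *)
Require Import Defs.
From HB Require Import structures.
From mathcomp Require Import all_boot all_order all_algebra finmap.
From mathcomp Require Import all_classical all_reals all_analysis.
From mathcomp Require Import measurable_realfun.
From mathcomp Require Import lra ring zify.
Set Implicit Arguments.
Unset Strict Implicit.
Unset Printing Implicit Defensive.
Import Order.TTheory GRing.Theory Num.Theory.
Import numFieldNormedType.Exports.
Local Open Scope classical_set_scope.
Local Open Scope ring_scope.

(** Let [U] in [[1, b)] be the significand of [X], that is, [X] divided by the
    power of [b] that brings it into that interval.  The digit of index [n.+1]
    of [X] is [a] exactly when [floor (b ^ n * U)] is [a] modulo [b], that is,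
    when [U] lies in the set [digit_set b a n].  These sets become
    equidistributed: they occupy, asymptotically, a share [1 / b] of every
    measurable subset of a bounded interval.  Any random variable with a density then sees them with
    limiting probability [1 / b], since integrating a fixed integrable function
    over sets that are spread so evenly gives the share [1 / b] in the limit.

    Equidistribution of [E n] with share [c] under a finite measure is the
    predicate [mixes].  For Lebesgue measure and intervals it follows from
    translation invariance ([le_residueS]): the sets of reals whose integer part
    is [k] and [k.+1] modulo [b] are translates of each other by 1, so inside
    any interval their lengths differ by at most 1.  The [b] residue classes
    partition the line, hence each has length [1 / b] of the interval up to an
    error [b], whatever the interval ([residue_length_dev]).  Contracting by
    [b ^ n] divides the error by [b ^ n] ([cvg_digit_set_itv]).

    The sets satisfying [mixes] form a Dynkin system, so the passage from
    intervals to Borel sets is the pi-lambda theorem ([mixes_measurable]).  A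
    finite measure [mu] dominated by [nu] has a Radon-Nikodym derivative, the
    increasing limit of simple functions, and for simple functions the claim is
    a finite sum of claims on sets ([mixes_dominated]).

    The law of [U] is dominated by Lebesgue measure on [`]0, b]]: if [A] is
    null, then [U] is in [A] only when [X] is in one of the countably many
    dilates [b ^ k * A], which are null too ([significand_dominated]). *)

(** * Equidistributed sequences of sets *)

(** Approximation by convergent sequences, uniformly in [n]: both the pi-lambda
    argument and the approximation of a density reduce to it. *)
Lemma cvg_of_close (R : realType) (u : R^nat) (v : R) :
  (forall e, 0 < e -> exists (x : R^nat) (y : R),
    [/\ x @ \oo --> y, forall n, `|u n - x n| <= e & `|v - y| <= e]) ->
  u @ \oo --> v.
Proof.
move=> H; apply/cvgrPdist_le => e e0.
have e3 : 0 < e / 3 by rewrite divr_gt0.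
have [x [y [/cvgrPdist_le /(_ _ e3) xy ux vy]]] := H _ e3.
near=> n.
have h1 : `|y - x n| <= e / 3 by near: n.
have h2 := ux n.
have -> : v - u n = (v - y) + (y - x n) - (u n - x n) by ring.
rewrite (le_trans (ler_normB _ _))// (_ : e = e / 3 + e / 3 + e / 3);
  last by field.
by rewrite lerD// (le_trans (ler_normD _ _))// lerD.
Unshelve. all: by end_near. Qed.

Section mixing.
Context d (T : measurableType d) (R : realType).
Variable nu : {finite_measure set T -> \bar R}.

Definition mass (A : set T) : R := fine (nu A).

Lemma massE A : measurable A -> nu A = (mass A)%:E.
Proof. by move=> mA; rewrite fineK// fin_num_measure. Qed.

Lemma mass_ge0 A : 0 <= mass A.
Proof. exact: fine_ge0. Qed.

Lemma massU A B : measurable A -> measurable B -> A `&` B = set0 ->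
  mass (A `|` B) = mass A + mass B.
Proof.
move=> mA mB AB; apply: EFin_inj; rewrite EFinD -!massE//;
  last exact: measurableU.
by rewrite measureU.
Qed.

Lemma massD A B : measurable A -> measurable B -> A `<=` B ->
  mass (B `\` A) = mass B - mass A.
Proof.
move=> mA mB AB; rewrite -[in mass B](setDUK AB) massU//.
- by rewrite [in RHS]addrC addKr.
- exact: measurableD.
- by rewrite setDE setICA setICr setI0.
Qed.

Lemma le_mass A B : measurable A -> measurable B -> A `<=` B ->
  mass A <= mass B.
Proof. by move=> mA mB AB; rewrite -subr_ge0 -massD// mass_ge0. Qed.

Variables (E : (set T)^nat) (c : R).
Hypothesis mE : forall n, measurable (E n).

(** Mixing in the sense of Renyi, with density [c], tested on the set [A]. *)
Definition mixes (A : set T) := mass (A `&` E n) @[n --> \oo] --> c * mass A.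

Lemma mixesC A : measurable A -> mixes setT -> mixes A -> mixes (~` A).
Proof.
move=> mA hT hA; rewrite /mixes -setTD massD// mulrBr.
rewrite (_ : (fun n => _) = (fun n => mass (setT `&` E n) - mass (A `&` E n))).
  exact: cvgB.
apply/funext => n; rewrite -massD//; [|exact: measurableI..|exact: setSI].
congr mass; apply/seteqP; split=> [x [[_ nA] Ex]|x [[_ Ex] nAE]].
  by split => // -[].
by split => //; split => // Ax; apply: nAE.
Qed.

Lemma mixesU A B : measurable A -> measurable B -> A `&` B = set0 ->
  mixes A -> mixes B -> mixes (A `|` B).
Proof.
move=> mA mB AB hA hB; rewrite /mixes massU// mulrDr.
rewrite (_ : (fun n => _) = (fun n => mass (A `&` E n) + mass (B `&` E n))).
  exact: cvgD.
apply/funext => n; rewrite setIUl massU//; [exact: measurableI..|].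
by rewrite setIACA AB set0I.
Qed.

(** All but finitely many of the [F k] carry a mass at most [e] together, which
    bounds the error on [A `&` E n] for every [n] at once. *)
Lemma mixes_bigcup (F : (set T)^nat) : 0 <= c <= 1 ->
  (forall n, measurable (F n)) -> trivIset setT F ->
  (forall n, mixes (F n)) -> mixes (\bigcup_k F k).
Proof.
move=> /andP[c0 c1] mF tF hF; pose A k := \big[setU/set0]_(i < k) F i.
have mA k : measurable (A k) by exact: bigsetU_measurable.
have hA k : mixes (A k).
  elim: k => [|k IHk]; rewrite /A ?big_ord0 ?big_ord_recr/=.
    rewrite /mixes /mass measure0 mulr0.
    under eq_fun do rewrite set0I measure0.
    exact: cvg_cst.
  apply: mixesU => //; first exact: mA.
  by apply: (@trivIset_bigsetUI _ predT) => //; rewrite /predT/= trueE.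
have mU : measurable (\bigcup_k F k) by exact: bigcup_measurable.
have AU k : A k `<=` \bigcup_k F k.
  by rewrite /A -bigcup_mkord; exact: bigcup_subset.
have ndA : nondecreasing_seq A.
  move=> i j ij; rewrite /A -!bigcup_mkord; apply/subsetPset.
  by apply: bigcup_subset => k /= /leq_trans; apply.
have UA : \bigcup_k A k = \bigcup_k F k.
  apply/seteqP; split=> [x [k _]|x [k _ Fx]]; first exact: AU.
  by exists k.+1 => //; rewrite /A big_ord_recr; right.
have /fine_cvg cA : nu (A k) @[k --> \oo] --> (mass (\bigcup_k F k))%:E.
  by rewrite -massE// -UA; apply: nondecreasing_cvg_mu => //; rewrite UA.
apply: cvg_of_close => e e0.
move/cvgrPdist_le : cA => /(_ _ e0)[k _ /(_ k (leqnn k))].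
rewrite /= -/(mass _) -massD// => ke.
have {}ke : mass (\bigcup_k F k `\` A k) <= e.
  by apply: le_trans ke; exact: ler_norm.
exists (fun n => mass (A k `&` E n)), (c * mass (A k)); split => //.
- exact: hA.
- move=> n; rewrite -massD; [|exact: measurableI..|exact: setSI].
  rewrite ger0_norm ?mass_ge0// (le_trans _ ke)// le_mass//.
  + by apply: measurableD; exact: measurableI.
  + exact: measurableD.
  + by move=> x [[Fx Ex] nA]; split => // Ax; apply: nA.
- rewrite -mulrBr -massD// normrM !ger0_norm ?mass_ge0// (le_trans _ ke)//.
  by rewrite ler_piMl ?mass_ge0.
Qed.

Lemma mixes_measurable (G : set (set T)) : 0 <= c <= 1 ->
  @measurable _ T = <<s G >> -> setI_closed G -> mixes setT ->
  (forall A, G A -> mixes A) -> forall A, measurable A -> mixes A.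
Proof.
move=> c01 GE GI hT hG A; rewrite GE; apply: dynkin_induction => //.
- by move=> B mB; exact: mixesC.
- by move=> F mF tF; exact: mixes_bigcup.
Qed.

End mixing.

(** * Passing to a dominated measure *)

Import HBNNSimple.

Section dominated.
Context d (T : measurableType d) (R : realType).
Variables nu mu : {finite_measure set T -> \bar R}.
Implicit Type g : {nnsfun T >-> R}.

(** The integral of [g] over [A], as a finite real sum: convergence can then be
    taken term by term. *)
Definition simple_mass g (A : set T) : R :=
  \sum_(r <- fset_set (range g)) r * mass nu (g @^-1` [set r] `&` A).

Lemma integral_simple_mass g A : measurable A ->
  (\int[nu]_(x in A) (g x)%:E = (simple_mass g A)%:E)%E.
Proof.
move=> mA; under eq_integral do rewrite fimfunE -fsumEFin//.
rewrite ge0_integral_fsum//; last 2 first.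
- by move=> r; exact/measurable_EFinP/measurable_funM.
- by move=> r x _; rewrite nnfun_muleindic_ge0.
rewrite fsbig_finite//= /simple_mass -sumEFin; apply: eq_bigr => r _.
rewrite integralZl_indic_nnsfun// integral_indic// EFinM -massE//.
exact: measurableI.
Qed.

Lemma simple_massC g A : measurable A ->
  simple_mass g setT = simple_mass g A + simple_mass g (~` A).
Proof.
move=> mA; rewrite -big_split/=; apply: eq_bigr => r _; rewrite -mulrDr.
rewrite -massU.
- by rewrite -setIUr setUv.
- exact: measurableI.
- by apply: measurableI => //; exact: measurableC.
- by rewrite setIACA setICr setI0.
Qed.

Variables (E : (set T)^nat) (c : R).
Hypothesis mE : forall n, measurable (E n).
Hypothesis c01 : 0 <= c <= 1.

Lemma mixes_simple g : (forall A, measurable A -> mixes nu E c A) ->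
  simple_mass g (E n) @[n --> \oo] --> c * simple_mass g setT.
Proof.
move=> h; rewrite /simple_mass mulr_sumr.
apply: cvg_big => [|r _]; first exact: add_continuous.
rewrite setIT mulrCA; apply: cvgMr; exact: h.
Qed.

(** With [f] the density of [mu] and [g k] simple functions increasing to [f],
    the defect [mu A - simple_mass (g k) A] is nonnegative and additive in [A].
    It is therefore largest on the whole space, so one [k] serves for all the
    sets [E n] simultaneously. *)
Lemma mixes_dominated : mu `<< nu ->
  (forall A, measurable A -> mixes nu E c A) -> mixes mu E c setT.
Proof.
move=> munu h.
have [f [f0 ffin intf fE]] := radon_nikodym_sigma_finite munu.
have mf : measurable_fun setT f by exact: measurable_int intf.
pose g k := nnsfun_approx measurableT mf k.
have gle k A : measurable A -> simple_mass (g k) A <= mass mu A.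
  move=> mA; rewrite -lee_fin -integral_simple_mass// -massE// fE//.
  apply: ge0_le_integral => //.
  - by move=> x _; rewrite lee_fin.
  - by apply/measurable_EFinP; exact: measurable_funTS.
  - exact: measurable_funTS.
  - by move=> x _; rewrite /g nnsfun_approxE; exact: le_approx.
have intg : (\int[nu]_x (g k x)%:E)%E @[k --> \oo] --> mu setT.
  rewrite fE// (_ : (\int[nu]_x f x)%E =
      (\int[nu]_x limn (fun k => (g k x)%:E))%E); last first.
    apply: eq_integral => x _; apply/esym/cvg_lim => //.
    exact: cvg_nnsfun_approx.
  apply: cvg_monotone_convergence => //.
  - by move=> k; exact/measurable_EFinP.
  - by move=> k x _; rewrite lee_fin.
  - by move=> x _ k l kl; rewrite lee_fin; exact/lefP/nd_nnsfun_approx.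
have gcvg : simple_mass (g k) setT @[k --> \oo] --> mass mu setT.
  rewrite (_ : (fun k => _) = fine \o (fun k => \int[nu]_x (g k x)%:E)%E).
    apply: fine_cvg; rewrite -massE//; exact: intg.
  by apply/funext => k; rewrite /= integral_simple_mass.
rewrite /mixes; apply: cvg_of_close => e e0.
move/cvgrPdist_le : gcvg => /(_ _ e0)[k _ /(_ k (leqnn k))].
have gleT := gle k _ measurableT; rewrite /= ger0_norm ?subr_ge0// => ke.
exists (fun n => simple_mass (g k) (E n)), (c * simple_mass (g k) setT); split.
- exact: mixes_simple.
- move=> n; rewrite setTI ger0_norm ?subr_ge0 ?gle//.
  rewrite (le_trans _ ke)// (simple_massC _ (mE n)).
  have mEC : measurable (~` E n) by exact: measurableC.
  rewrite -(setUv (E n)) massU ?setICr//.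
  by have := gle k _ mEC; lra.
- case/andP: c01 => c0 c1; rewrite -mulrBr ger0_norm; last first.
    by rewrite mulr_ge0// subr_ge0.
  by rewrite (le_trans _ ke)// ler_piMl// subr_ge0.
Qed.
End dominated.

(** * Integer parts modulo b *)

Section lebesgue.
Context (R : realType).
Local Notation lambda := (@lebesgue_measure R).

Lemma affine_preimage_itv (c h x y : R) : 0 < c ->
  (fun z => c * z + h) @^-1` `]x, y] = `](x - h) / c, (y - h) / c]%classic.
Proof.
move=> c0; apply/seteqP; split=> z /=; rewrite !in_itv/=;
  by rewrite ltr_pdivrMr// ler_pdivlMr// ltrBlDr lerBrDr mulrC.
Qed.

Lemma lebesgue_measure_affine (c h : R) (A : set R) : 0 < c -> measurable A ->
  lambda ((fun z => c * z + h) @^-1` A) = (c^-1%:E * lambda A)%E.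
Proof.
move=> c0 mA.
have mf : measurable_fun [set: measurableTypeR R]
    ((fun z => c * z + h) : _ -> measurableTypeR R).
  apply: measurable_funD => //; exact: measurable_funM.
pose f : measurableTypeR R -> measurableTypeR R := fun z => c * z + h.
(* The pushforward is a measure only given the measurability of [f]. *)
unshelve epose (m := mscale (NngNum (ltW c0)) (pushforward lambda f) :
  {measure set (measurableTypeR R) -> \bar R}); first exact: mf.
have -> : lambda A = m A.
  apply: lebesgue_measure_unique => // _ [[x y] _ <-]/=.
  rewrite /m /mscale/= /pushforward/= affine_preimage_itv//.
  rewrite !lebesgue_measure_itv/= !lte_fin ltr_pM2r ?invr_gt0// ltrD2r.
  case: ifPn => _; last by rewrite mule0.
  rewrite -!EFinB -EFinM; congr EFin; field; exact: lt0r_neq0.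
by rewrite /m /mscale/= muleA -EFinM mulVf ?mul1e// lt0r_neq0.
Qed.

Definition residue (b k : nat) : set R :=
  [set x | (Num.floor x = k%:Z %[mod b])%Z].

Lemma measurable_residue b k : measurable (residue b k).
Proof.
rewrite (_ : residue b k = \bigcup_(m in [set m : int | (m = k %[mod b])%Z])
    `[m%:~R, (m + 1)%:~R[%classic).
  rewrite bigcup_mkcond; apply: countable_bigcupT_measurable => // m.
  by case: ifP.
apply/seteqP; split=> [x xk|x [m mk]].
  by exists (Num.floor x) => //=; rewrite in_itv/= floor_itv.
by rewrite /= in_itv/= => /floor_def xm; rewrite /residue/= xm.
Qed.

Lemma residueS b k : (fun z => 1 * z + 1) @^-1` residue b k.+1 = residue b k.
Proof.
apply/seteqP; split=> z; rewrite /residue /= mul1r floorDrz ?int_num1// floor1.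
  by move=> /eqP; rewrite -addn1 PoszD eqz_modDr => /eqP.
by move=> /eqP h; apply/eqP; rewrite -addn1 PoszD eqz_modDr.
Qed.

Lemma residueDl b k : residue b (k + b) = residue b k.
Proof. by rewrite /residue PoszD modzDr. Qed.

(** Translating by one turns residue [k.+1] into residue [k] and moves the
    interval [`]x, y]] to [`]x - 1, y - 1]], which sticks out of [`]x, y]] only
    by a piece of length at most 1. *)
Lemma le_residueS b k (x y : R) : x <= y ->
  (lambda (`]x, y] `&` residue b k.+1) <=
   lambda (`]x, y] `&` residue b k) + 1%:E)%E.
Proof.
move=> xy; have mr := measurable_residue.
have mJS : measurable (`]x, y] `&` residue b k.+1) by exact: measurableI.
have := lebesgue_measure_affine 1 ltr01 mJS.
rewrite invr1 mul1e => <-.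
rewrite preimage_setI residueS affine_preimage_itv// !divr1.
have <- : lambda `]x - 1, x]%classic = 1%:E.
  rewrite lebesgue_measure_itv/= lte_fin ltrBlDr ltrDl ltr01 -EFinB.
  by congr EFin; ring.
have mJ : measurable (`]x, y] `&` residue b k) by exact: measurableI.
have := measureU2 lambda mJ (measurable_itv `]x - 1, x]); apply: le_trans.
apply: le_measure; rewrite ?inE//.
- exact: (measurableI _ _ (measurable_itv _) (mr _ _)).
- exact: (measurableU _ _ mJ (measurable_itv _)).
move=> z [/= zxy zr]; move: zxy; rewrite in_itv/= => /andP[xz zy].
have [zx|zx] := leP z x; [right|left]; first by rewrite /= in_itv/= xz zx.
by split => //=; rewrite in_itv/= zx (le_trans zy)//; lra.
Qed.

Lemma le_residueD b k i (x y : R) : x <= y ->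
  (lambda (`]x, y] `&` residue b (k + i)) <=
   lambda (`]x, y] `&` residue b k) + i%:R%:E)%E.
Proof.
move=> xy; elim: i => [|i IHi]; first by rewrite addn0 adde0.
rewrite addnS (le_trans (le_residueS _ _ xy))//.
by rewrite -natr1 EFinD addeA leeD2r.
Qed.

Lemma bigsetU_residue b : (0 < b)%N ->
  \big[setU/set0]_(i < b) residue b i = setT.
Proof.
move=> b0; rewrite -bigcup_mkord; apply/seteqP; split=> // x _.
have b0' : b%:Z != 0 by rewrite eqz_nat -lt0n.
exists `|(Num.floor x %% b)%Z|%N.
  by rewrite /= -ltz_nat gez0_abs ?modz_ge0// ltz_pmod.
by rewrite /residue/= gez0_abs ?modz_ge0// modz_mod.
Qed.

Lemma trivIset_residue b : trivIset `I_b (residue b).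
Proof.
move=> i j /= ib jb [x [/= xi xj]].
move: (etrans (esym xi) xj); rewrite !modz_small ?ltz_nat//.
by case.
Qed.

Definition residue_length b k (x y : R) : R :=
  fine (lambda (`]x, y] `&` residue b k)).

Lemma residue_lengthE b k (x y : R) :
  lambda (`]x, y] `&` residue b k) = (residue_length b k x y)%:E.
Proof.
rewrite fineK// ge0_fin_numE//; apply: (@le_lt_trans _ _ (lambda `]x, y])).
  apply: le_measure; rewrite ?inE//=.
  exact: (measurableI _ _ (measurable_itv _) (measurable_residue _ _)).
by rewrite lebesgue_measure_itv/=; case: ifP => // _; rewrite -EFinB ltry.
Qed.

Lemma sum_residue_length b (x y : R) : (0 < b)%N -> x <= y ->
  \sum_(k < b) residue_length b k x y = y - x.
Proof.
move=> b0 xy; apply: EFin_inj; rewrite -sumEFin.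
under eq_bigr do rewrite -residue_lengthE.
rewrite -[LHS](@measure_semi_additive_ord_I _ _ _ lambda
  (fun k => `]x, y] `&` residue b k)).
- rewrite -big_distrr/= bigsetU_residue// setIT lebesgue_measure_itv/= lte_fin.
  by case: ltgtP xy => // -> _; rewrite subrr.
- move=> k _.
  exact: (measurableI _ _ (measurable_itv _) (measurable_residue _ _)).
- exact/trivIset_setIl/trivIset_residue.
- rewrite -big_distrr/= bigsetU_residue// setIT; exact: measurable_itv.
Qed.

(** Any residue class is reached from any other by fewer than [b] upward steps,
    going round modulo [b] if needed, so the bound holds for every ordered pair
    of classes. *)
Lemma residue_length_close b a k (x y : R) : (a < b)%N -> (k < b)%N -> x <= y ->
  residue_length b a x y <= residue_length b k x y + b%:R.
Proof.
move=> ab kb xy; rewrite -lee_fin EFinD -!residue_lengthE.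
have [ka|ak] := leqP k a.
  rewrite -[in leLHS](subnKC ka) (le_trans (le_residueD _ _ _ xy))// leeD2l//.
  rewrite lee_fin ler_nat.
  by rewrite (leq_trans (leq_subr _ _))// ltnW.
rewrite -(residueDl b a) -[in leLHS](@subnKC k (a + b)); last first.
  by rewrite (leq_trans (ltnW kb))// leq_addl.
by rewrite (le_trans (le_residueD _ _ _ xy))// leeD2l// lee_fin ler_nat; lia.
Qed.

(** The error does not depend on the interval: this is what makes it disappear
    after rescaling. *)
Lemma residue_length_dev b a (x y : R) : (a < b)%N -> x <= y ->
  `|residue_length b a x y - b%:R^-1 * (y - x)| <= b%:R.
Proof.
move=> ab xy; have b0 : (0 < b)%N by exact: leq_ltn_trans ab.
have bR : 0 < b%:R :> R by rewrite ltr0n.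
have -> : residue_length b a x y - b%:R^-1 * (y - x) =
    b%:R^-1 * (\sum_(k < b) (residue_length b a x y - residue_length b k x y)).
  rewrite sumrB sum_residue_length// sumr_const card_ord.
  rewrite -(mulr_natl (residue_length b a x y)).
  by rewrite [RHS]mulrBr mulKf// gt_eqF.
rewrite normrM ger0_norm ?invr_ge0 ?ler0n// ler_pdivrMl//.
rewrite (le_trans (ler_norm_sum _ _ _))//.
have : \sum_(k < b) `|residue_length b a x y - residue_length b k x y| <=
    \sum_(k < b) (b%:R : R).
  apply: ler_sum => k _; rewrite ler_distlC; apply/andP; split.
    by rewrite lerBlDr residue_length_close.
  by rewrite residue_length_close.
by rewrite sumr_const card_ord -(mulr_natl b%:R).
Qed.

End lebesgue.

(** * Equidistribution of the digit sets *)

Section digits.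
Context (R : realType) (b : nat).
Hypothesis b_gt1 : (1 < b)%N.
Local Notation lambda := (@lebesgue_measure R).

(** The null translation keeps [lebesgue_measure_affine] applicable as it
    stands. *)
Definition digit_set (a n : nat) : set R :=
  (fun z => b%:R ^+ n * z + 0) @^-1` @residue R b a.

Let bn_gt0 n : 0 < b%:R ^+ n :> R.
Proof. by rewrite exprn_gt0// ltr0n ltnW. Qed.

Lemma measurable_digit_set a n : measurable (digit_set a n).
Proof.
have mf : measurable_fun [set: R] (fun z : R => b%:R ^+ n * z + 0).
  by apply: measurable_funD => //; exact: measurable_funM.
rewrite -[X in measurable X]setTI; apply: mf => //; exact: measurable_residue.
Qed.

Lemma digit_set_itv (a n : nat) (x y : R) :
  fine (lambda (`]x, y] `&` digit_set a n)) =
  (b%:R ^+ n)^-1 * residue_length b a (b%:R ^+ n * x) (b%:R ^+ n * y).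
Proof.
have -> : `]x, y]%classic =
    (fun z => b%:R ^+ n * z + 0) @^-1` `](b%:R ^+ n * x), (b%:R ^+ n * y)].
  by rewrite affine_preimage_itv// !subr0 ![_ / _]mulrC !mulKf// gt_eqF.
rewrite -preimage_setI lebesgue_measure_affine//.
  by rewrite residue_lengthE -EFinM.
exact: (measurableI _ _ (measurable_itv _) (measurable_residue _ _)).
Qed.

Lemma cvg_digit_set_itv a (x y : R) : (a < b)%N -> x <= y ->
  fine (lambda (`]x, y] `&` digit_set a n)) @[n --> \oo] --> b%:R^-1 * (y - x).
Proof.
move=> ab xy; have : geometric b%:R (b%:R^-1) @ \oo --> (0 : R).
  apply: cvg_geometric; rewrite ger0_norm ?invr_ge0// invf_lt1 ?ltr1n//.
  by rewrite ltr0n ltnW.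
move=> /cvgrPdist_le g0; apply/cvgrPdist_le => e e0.
near=> n; have : `|0 - geometric b%:R b%:R^-1 n| <= e :> R.
  by near: n; exact: g0.
rewrite sub0r normrN; apply: le_trans; rewrite (le_trans _ (ler_norm _))//.
rewrite digit_set_itv distrC /geometric/= exprVn [leRHS]mulrC.
rewrite (_ : b%:R^-1 * (y - x) =
    (b%:R ^+ n)^-1 * (b%:R^-1 * (b%:R ^+ n * y - b%:R ^+ n * x))); last first.
  by rewrite -mulrBr [RHS]mulrCA mulKf// gt_eqF.
rewrite -mulrBr normrM gtr0_norm ?invr_gt0// ler_pM2l ?invr_gt0//.
by apply: residue_length_dev => //; rewrite ler_pM2l.
Unshelve. all: by end_near. Qed.

Lemma lebesgue_itv0b_fin : (lambda `]0%R, b%:R] < +oo)%E.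
Proof.
by rewrite lebesgue_measure_itv/=; case: ifP => // _; rewrite -EFinB ltry.
Qed.

Definition lebesgue0b : {finite_measure set (measurableTypeR R) -> \bar R} :=
  @mfrestr _ (measurableTypeR R) R `]0, b%:R]%classic lambda
    (measurable_itv `]0, b%:R]) lebesgue_itv0b_fin.

(** The half-open intervals form a pi-system generating the Borel sets, and cut
    by [`]0, b]] they remain half-open intervals. *)
Lemma mixes_digit_set a A : (a < b)%N -> measurable A ->
  mixes lebesgue0b (digit_set a) b%:R^-1 A.
Proof.
move=> ab mA.
have main B : ocitv (B `&` `]0, b%:R]) ->
    mixes lebesgue0b (digit_set a) b%:R^-1 B.
  rewrite /mixes /mass /lebesgue0b/= /mfrestr /mrestr => oB.
  under eq_fun do rewrite setIAC.
  case/ocitvP : oB => [->|[[x y] /= xy ->]].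
    under eq_fun do rewrite set0I.
    by rewrite measure0/= mulr0; exact: cvg_cst.
  rewrite [in X in _ * X]lebesgue_measure_itv/= lte_fin xy -EFinB/=.
  by apply: cvg_digit_set_itv => //; exact: ltW.
apply: (@mixes_measurable _ (measurableTypeR R) R lebesgue0b (digit_set a)
  b%:R^-1 _ (@ocitv R)) => //.
- by move=> n; exact: measurable_digit_set.
- by rewrite invr_ge0 ler0n invf_le1 ?ltr0n 1?ltnW// ler1n ltnW.
- exact: ocitvI.
- by apply: main; rewrite setTI; exact: is_ocitv.
- by move=> B oB; apply: main; apply: ocitvI => //; exact: is_ocitv.
Qed.

End digits.

(** * The law of the significand *)

Section significand.
Context (R : realType) (b : nat).
Hypothesis b_gt1 : (1 < b)%N.
Local Notation lambda := (@lebesgue_measure R).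

Definition significand (x : R) : R := b%:R `^ fracpart (logb b x).

Let lnb_gt0 : 0 < ln b%:R :> R.
Proof. by rewrite ln_gt0// ltr1n. Qed.

Lemma measurable_significand : measurable_fun [set: R] significand.
Proof.
have ml : measurable_fun setT (@logb R b) by apply: measurable_funM.
have mfl : measurable_fun setT (fun z : R => (Num.floor z)%:~R : R).
  by apply: nondecreasing_measurable => // x y xy; rewrite ler_int le_floor.
have mfr : measurable_fun setT (fun x : R => fracpart (logb b x)).
  by apply: measurable_funB => //; exact: measurableT_comp mfl ml.
exact: (measurableT_comp (measurable_powRr (b%:R : R)) mfr).
Qed.

Lemma digitE (a n : nat) (x : R) : (a < b)%N ->
  digit b n.+1 x = a <-> digit_set b a n (significand x).
Proof.
move=> ab; rewrite /digit /int_significand /digit_set /residue/= addr0.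
have bR : b%:R != 0 :> R by rewrite pnatr_eq0 -lt0n ltnW.
rewrite -natr1 addrA addrK powRD; last by rewrite bR implybT.
rewrite powR_mulrn// mulrC -/(significand x).
by rewrite [X in _ <-> _ = X]modz_small.
Qed.

Lemma significand_itv x : significand x \in `]0, b%:R].
Proof.
rewrite in_itv/= powR_gt0 ?ltr0n 1?ltnW//=.
rewrite -[leRHS]powRr1// ler_powR ?ler1n 1?ltnW// /fracpart.
have /andP[_ /ltW] := floor_itv (logb b x).
by rewrite intrD lerBlDl.
Qed.

(** The power [b ^ (- k)], for an integer [k] of any sign. *)
Definition inv_power (k : int) : R := expR (- (k%:~R * ln b%:R)).

(** For fixed value of the floor this is linear in [x]: the significand acts on
    the positive reals by countably many dilations. *)
Lemma significand_inv_power x : 0 < x ->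
  significand x = inv_power (Num.floor (logb b x)) * x + 0.
Proof.
move=> x0; rewrite addr0 /significand /inv_power /powR gt_eqF ?ltr0n 1?ltnW//.
rewrite -[X in _ = _ * X]lnK// -expRD /fracpart {1}/logb; congr expR.
by field; rewrite gt_eqF.
Qed.

Variables (d : measure_display) (T : measurableType d) (P : probability T R).
Variables (X : {RV P >-> R}).

Lemma measurable_significand_RV :
  measurable_fun [set: T] (significand \o X : T -> measurableTypeR R).
Proof. by apply: measurableT_comp => //; exact: measurable_significand. Qed.

Definition significand_RV : {RV P >-> measurableTypeR R} :=
  @mfun_Sub _ _ T (measurableTypeR R) _ (mem_set measurable_significand_RV).

Hypothesis X_gt0 : {ae P, forall t, 0 < X t}.
Hypothesis X_cont : continuous_RV X.

Lemma continuous_null A : measurable A -> lambda A = 0%E -> P (X @^-1` A) = 0%E.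
Proof.
move=> mA A0; case: X_cont => f [mf f0 fE].
rewrite -[LHS]/(distribution P X A) fE//; apply: null_set_integral => //.
by apply/measurable_EFinP; exact: measurable_funTS.
Qed.

(** A null set of significands pulls back to countably many dilates of itself,
    all null for Lebesgue measure, hence for the law of [X]. *)
Lemma significand_dominated :
  distribution P significand_RV `<< lebesgue0b R b.
Proof.
apply/null_content_dominatesP => A mA nuA.
pose S k := (fun z => inv_power k * z + 0) @^-1` (A `&` `]0%R, b%:R]).
have mAb : measurable (A `&` `]0%R, b%:R]) by exact: measurableI.
have mS k : measurable (S k : set R).
  rewrite -[X in measurable X]setTI.
  have mf : measurable_fun [set: R] (fun z : R => inv_power k * z + 0).
    by apply: measurable_funD => //; exact: measurable_funM.
  exact: mf.
have S0 k : P (X @^-1` (S k)) = 0%E.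
  apply: continuous_null; first exact: mS.
  have -> := lebesgue_measure_affine 0 (expR_gt0 (- (k%:~R * ln b%:R))) mAb.
  by rewrite [X in (_ * X)%E]nuA mule0.
(* An enumeration of the integers, the union being indexed by naturals. *)
pose e (i : nat) : int := odflt 0 (choice.unpickle i).
have : P.-negligible (significand_RV @^-1` A).
  have nS : P.-negligible (\bigcup_i (X @^-1` (S (e i)))).
    apply: negligible_bigcup => i; exists (X @^-1` (S (e i))); split => //.
      by rewrite -[X in measurable X]setTI; exact: measurable_funPT.
    exact: S0.
  apply: negligibleS (negligibleU X_gt0 nS) => t At.
  have [Xt|Xt] := pselect (0 < X t); [right|by left].
  exists (choice.pickle (Num.floor (logb b (X t)))) => //.
  rewrite /e choice.pickleK /S/= -significand_inv_power//; split => //.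
  exact: significand_itv.
apply: measure_negligible => //.
by rewrite -[X in measurable X]setTI; exact: measurable_funPT.
Qed.

End significand.

(** * Limit law of the digits *)

Theorem theorem2p2 (d : measure_display) (T : measurableType d)
    (R : realType) (P : probability T R) (X : {RV P >-> R}) (b : nat)
    (hb : (2 <= b)%N)
    (X_gt0 : {ae P, forall t, 0 < X t})
    (X_cont : continuous_RV X)
    (a : nat) (ha : (a < b)%N) :
  P [set t | digit b j (X t) = a%:Z] @[j --> \oo] --> ((b%:R : R)^-1)%:E.
Proof.
have c01 : 0 <= (b%:R : R)^-1 <= 1.
  by rewrite invr_ge0 ler0n invf_le1 ?ltr0n 1?ltnW// ler1n ltnW.
have := @mixes_dominated _ (measurableTypeR R) R (lebesgue0b R b)
  (distribution P (significand_RV b X)) (digit_set b a) b%:R^-1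
  (@measurable_digit_set R b a) c01 (significand_dominated hb X_gt0 X_cont)
  (fun A => mixes_digit_set hb ha).
rewrite /mixes (_ : mass _ setT = 1); last first.
  by rewrite /mass/= /distribution /pushforward preimage_setT probability_setT.
rewrite mulr1 => cvP.
(* The digit sets describe the digits from index 1 on. *)
rewrite -(cvg_shiftS (fun j => P [set t | digit b j (X t) = a%:Z])).
have PE n : P [set t | digit b n.+1 (X t) = a%:Z] =
    distribution P (significand_RV b X) ([set: R] `&` digit_set b a n).
  rewrite /distribution /pushforward setTI; congr (P _).
  by apply/seteqP; split=> t /=; move/(digitE hb n (X t) ha).
under eq_fun do rewrite /= PE.
apply/fine_cvgP; split; last exact: cvP.
apply: nearW => n; apply: fin_num_measure; rewrite setTI.
exact: measurable_digit_set.
Qed.
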